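(* Let $\mathcal{A}$ be an $n$-dimensional arrangement of $m$ hyperplanes of rank $r=r(\mathcal{A})$, with characteristic polynomial \[ \chi(\mathcal{A};t)=a_0t^n-a_1t^{n-1}+a_2t^{n-2}+\cdots+(-1)^ra_rt^{n-r}. \] Then \[ \binom{r-1}{k}\le (-1)^k\sum_{i=0}^{k}(-1)^ia_{i}\le \binom{m-1}{k}\qquad\text{for } 0\le k\le r. \]
   Context: An $n$-dimensional hyperplane arrangement $\mathcal{A}$ is a finite set of (affine, not necessarily through the origin) hyperplanes in an $n$-dimensional vector space $V$. The intersection semi-lattice $L(\mathcal{A})$ is the set of all nonempty intersections $\bigcap_{H\in\mathcal{B}}H$ with $\mathcal{B}\subseteq\mathcal{A}$, including $V=\bigcap_{H\in\emptyset}H$, partially ordered by reverse inclusion; its minimal element is $\hat 0=V$. The rank $r(\mathcal{A})$ is the maximal rank of $L(\mathcal{A})$, equivalently the dimension of the span of the normal vectors of the hyperplanes in $\mathcal{A}$. The characteristic polynomial is $\chi(\mathcal{A};t)=\sum_{X\in L(\mathcal{A})}\mu(\hat 0,X)\,t^{\dim X}$, where $\mu$ is the Möbius function of $L(\mathcal{A})$. For $\alpha\in\mathbb{C}$ and $k\in\mathbb{Z}_{\ge0}$, $\binom{\alpha}{k}=\frac{1}{k!}\alpha(\alpha-1)\cdots(\alpha-k+1)$ is the generalized binomial coefficient (so $\binom{\alpha}{0}=1$). *)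

(* Defs.v *)
From HB Require Import structures.
From mathcomp Require Export all_boot all_order all_algebra finmap.
From mathcomp Require Export boolp classical_sets.
Set Implicit Arguments.
Unset Strict Implicit.
Unset Printing Implicit Defensive.
Export Order.TTheory GRing.Theory Num.Theory.
Local Open Scope ring_scope.

Definition gbinom (F : numFieldType) (alpha : F) (k : nat) : F :=
  (\prod_(i < k) (alpha - i%:R)) / k`!%:R.

Section Poset.
Variables (d : Order.disp_t) (T : finPOrderType d).
Implicit Types x y z : T.
Local Open Scope order_scope.

(* N is only recursion fuel: any N exceeding the length of every chain from x
   to y gives the same value, see mobiusxx and mobius_sum0. *)
Fixpoint mobius_rec (N : nat) (x y : T) : int :=
  if N is N'.+1 then
    if x == y then 1%R
    else if x < y then (- \sum_(z : T | (x <= z < y)%O) mobius_rec N' x z)%R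
    else 0%R
  else 0%R.

Definition mobius (x y : T) : int := mobius_rec #|T| x y.

Lemma mobius_rec_fuel N M x y :
  (#|[set z : T | (z <= y)%O]| <= N)%N -> (#|[set z : T | (z <= y)%O]| <= M)%N ->
  mobius_rec N x y = mobius_rec M x y.
Proof.
have h0 u : (#|[set z : T | (z <= u)%O]| <= 0)%N = false.
  by rewrite leqn0 cards_eq0; apply/negP => /eqP/setP/(_ u); rewrite !inE lexx.
elim: N M y => [|N IH] [|M] y; rewrite ?h0 // => hN hM /=.
case: eqVneq => // _; case: ifP => // _.
congr (- _)%R; apply: eq_bigr => z /andP[_ zy].
have lt_card : (#|[set u : T | (u <= z)%O]| < #|[set u : T | (u <= y)%O]|)%N.
  apply/proper_card/properP; split.
    by apply/fintype.subsetP => u; rewrite !inE => /le_trans; apply; exact: ltW.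
  by exists y; rewrite !inE ?lexx // lt_geF.
by apply: IH; rewrite -ltnS; [exact: leq_trans hN | exact: leq_trans hM].
Qed.

Lemma mobiusxx x : mobius x x = 1%R.
Proof.
rewrite /mobius; have : (0 < #|T|)%N by apply/card_gt0P; exists x.
by case: #|T| => //= n _; rewrite eqxx.
Qed.

Lemma mobius_sum0 x y :
  x < y -> (\sum_(z : T | (x <= z <= y)%O) mobius x z = 0)%R.
Proof.
move=> xy; rewrite (bigD1 y) /=; last by rewrite lexx ltW.
have -> : mobius x y = (- \sum_(z : T | (x <= z < y)%O) mobius x z)%R.
  rewrite /mobius (@mobius_rec_fuel #|T| #|T|.+1) ?(leqW (max_card _)) ?max_card //=.
  by rewrite lt_eqF // xy.
rewrite addrC; apply/eqP; rewrite subr_eq0; apply/eqP/eq_bigl => z.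
by rewrite lt_neqAle -andbA [(z != y) && _]andbC.
Qed.

(* length of a longest chain of elements below x *)
Definition poset_height (x : T) : nat :=
  \max_(C : {set T} | [forall y in C, (y <= x) && [forall z in C, y >=< z]])
     #|C|.-1.

Definition poset_rank : nat := \max_(x : T) poset_height x.

End Poset.

Section Arrangement.
Variables (K : fieldType) (V : vectType K).
Local Open Scope classical_set_scope.

Definition affine_subspace (x : V) (U : {vspace V}) : set V :=
  [set y | y - x \in U].

Definition is_hyperplane (H : set V) : Prop :=
  exists (x : V) (U : {vspace V}),
    (\dim U).+1 = \dim {: V} /\ H = affine_subspace x U.

(* The linear subspace U with X = x + U for some x; it is unique if it exists,
   and the junk value 0 is used if X is not an affine subspace. *)
Definition direction (X : set V) : {vspace V} :=
  xget 0%VS [set U | exists x : V, X = affine_subspace x U].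

Definition affine_dim (X : set V) : nat := \dim (direction X).

Lemma affine_dimE (x : V) (U : {vspace V}) :
  affine_dim (affine_subspace x U) = \dim U.
Proof.
have [y eqW] : exists y, affine_subspace x U
    = affine_subspace y (direction (affine_subspace x U)).
  by apply: (@xgetPex _ 0%VS
      [set W | exists y, affine_subspace x U = affine_subspace y W]); exists U, x.
rewrite /affine_dim; move: (direction _) eqW => W eqW.
have yx : y - x \in U.
  by have : affine_subspace x U y by rewrite eqW /affine_subspace /= subrr mem0v.
suff -> : W = U by [].
apply/vspaceP => v.
have : affine_subspace x U (v + y) = affine_subspace y W (v + y) by rewrite eqW.
rewrite /affine_subspace /= addrK -addrA => /propeqP e.
by apply/idP/idP => [/e/(memvB)/(_ yx)|vU]; [rewrite addrK|apply/e/memvD].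
Qed.

Definition intersections (A : {fset set V}) : {fset set V} :=
  [fset X in [fset \bigcap_(H in [set` (B : {fset set V})]) H
               | B in fpowerset A] | `[< X !=set0 >]]%fset.

Definition intersection_poset (A : {fset set V}) : Type :=
  fset_sub_type (intersections A).

End Arrangement.

Fact intersection_display : Order.disp_t. Proof. exact: Order.Disp tt tt. Qed.

Section IntersectionPoset.
Variables (K : fieldType) (V : vectType K) (A : {fset set V}).
Local Open Scope classical_set_scope.
Local Notation L := (intersection_poset A).

HB.instance Definition _ := Finite.on L.

Definition rev_incl (X Y : L) : bool := `[< val Y `<=` val X >].

Fact rev_incl_refl : reflexive rev_incl.
Proof. by move=> X; apply/asboolP. Qed.

Fact rev_incl_anti : antisymmetric rev_incl.
Proof.
move=> X Y /andP[/asboolP YX /asboolP XY].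
by apply/val_inj/seteqP; split.
Qed.

Fact rev_incl_trans : transitive rev_incl.
Proof.
by move=> Y X Z /asboolP YX /asboolP ZY; apply/asboolP; exact: subset_trans YX.
Qed.

HB.instance Definition _ := Order.Le_isPOrder.Build intersection_display L
  rev_incl_refl rev_incl_anti rev_incl_trans.

Fact setT_intersection : [set: V] \in intersections A.
Proof.
have E : \bigcap_(H in [set` (fset0 : {fset set V})]) H = [set: V].
  by rewrite set_fset0 bigcap_set0.
rewrite !inE /=; apply/andP; split; last by apply/asboolP; exists 0.
by rewrite -E; apply: in_imfset; rewrite /= fpowersetE fsub0set.
Qed.

Definition whole_space : L := FSetSub setT_intersection.

Fact whole_space_le (X : L) : (whole_space <= X)%O.
Proof. by apply/asboolP. Qed.

HB.instance Definition _ :=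
  Order.hasBottom.Build intersection_display L whole_space_le.

Definition arrangement_rank : nat := poset_rank L.

Definition characteristic_poly : {poly int} :=
  \sum_(X : L) mobius (\bot)%O X *: 'X^(affine_dim (val X)).

End IntersectionPoset.

(* Main.v *)
(* By Whitney's theorem the alternating sum in the statement is, up to sign, the
   inclusion-exclusion sum f_k(V, A) of (-1)^#|B| over the B included in A whose
   intersection is nonempty of codimension at most k. For an affine subspace X of
   codimension c, set b_k(X, A) = (-1)^k f_(c+k)(X, A), where f_j(X, A) is the same
   sum with every intersection cut by X. Deletion-restriction reads
   b_k(X, H :: s) = b_k(X, s) + b_(k-1)(X `&` H, s), which matches Pascal's rule
   and gives both bounds by induction on s for all X at once. If the restriction
   to X `&` H degenerates because some hyperplane of s contains X `&` H, its
   contribution vanishes; if H is independent of s, then X and X `&` H have the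
   same sequence b. *)
Require Import Defs.
From mathcomp Require Import all_boot all_order all_algebra finmap.
From mathcomp Require Import boolp classical_sets.
From mathcomp Require Import zify.
Local Open Scope ring_scope.

(** * Affine subspaces, their directions and their intersections *)

Section AffineSubspaces.
Set Implicit Arguments.
Unset Strict Implicit.
Variables (K : fieldType) (V : vectType K).
Local Open Scope classical_set_scope.
Implicit Types (X Y H : set V) (U W : {vspace V}).

Definition is_affine X := exists x U, X = affine_subspace x U.

Lemma hyperplane_affine H : is_hyperplane H -> is_affine H.
Proof. by move=> [x [U [_ ->]]]; exists x, U. Qed.

Lemma affine_subspace_at x y U :
  affine_subspace x U y -> affine_subspace x U = affine_subspace y U.
Proof.
rewrite /affine_subspace /= => yx; apply/seteqP; split=> z /= zx.
  by rewrite -(subrKA x) -[x - y]opprB memvB.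
by rewrite -(subrKA y) memvD.
Qed.

Lemma affine_subspace_inj x y U W :
  affine_subspace x U = affine_subspace y W -> U = W.
Proof.
move=> eqUW; have xy : affine_subspace y W x.
  by rewrite -eqUW /affine_subspace /= subrr mem0v.
rewrite (affine_subspace_at xy) in eqUW.
apply/vspaceP => v.
have : affine_subspace x U (v + x) = affine_subspace x W (v + x) by rewrite eqUW.
by rewrite /affine_subspace /= addrK => /propeqP e; apply/idP/idP => /e.
Qed.

Lemma direction_affine x U : direction (affine_subspace x U) = U.
Proof.
have [y] : exists y, affine_subspace x U
    = affine_subspace y (direction (affine_subspace x U)).
  by apply: (@xgetPex _ 0%VS
      [set W | exists y, affine_subspace x U = affine_subspace y W]); exists U, x.
by move/affine_subspace_inj.
Qed.

Lemma affineE X x : is_affine X -> X x -> X = affine_subspace x (direction X).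
Proof.
by move=> [y [U ->]] Xx; rewrite direction_affine; exact: affine_subspace_at.
Qed.

Lemma affine_neq0 X : is_affine X -> X !=set0.
Proof.
by move=> [x [U ->]]; exists x; rewrite /affine_subspace /= subrr mem0v.
Qed.

Lemma affineT : is_affine [set: V].
Proof.
by exists 0, fullv; apply/seteqP; split=> // x _; rewrite /affine_subspace /= memvf.
Qed.

Lemma directionT : direction [set: V] = fullv.
Proof.
rewrite -(direction_affine 0 fullv); congr direction.
by apply/seteqP; split=> // x _; rewrite /affine_subspace /= memvf.
Qed.

Lemma setI_affineE x X Y : is_affine X -> is_affine Y -> X x -> Y x ->
  X `&` Y = affine_subspace x (direction X :&: direction Y).
Proof.
move=> affX affY Xx Yx.
rewrite {1}(affineE affX Xx) {1}(affineE affY Yx) /affine_subspace.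
by apply/seteqP; split=> z /=; rewrite memv_cap => /andP.
Qed.

Lemma affineI X Y : is_affine X -> is_affine Y -> X `&` Y !=set0 ->
  is_affine (X `&` Y).
Proof.
move=> affX affY [x [Xx Yx]]; rewrite (setI_affineE affX affY Xx Yx).
by eexists; eexists.
Qed.

Lemma directionI X Y : is_affine X -> is_affine Y -> X `&` Y !=set0 ->
  direction (X `&` Y) = (direction X :&: direction Y)%VS.
Proof.
move=> affX affY [x [Xx Yx]].
by rewrite (setI_affineE affX affY Xx Yx) direction_affine.
Qed.

Lemma affine_subset X Y : is_affine X -> is_affine Y -> X `&` Y !=set0 ->
  (direction X <= direction Y)%VS -> X `<=` Y.
Proof.
move=> affX affY [x [Xx Yx]] sub z.
rewrite (affineE affX Xx) (affineE affY Yx) /affine_subspace /=.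
exact: (subvP sub).
Qed.

Lemma affine_subset_eq X Y : is_affine X -> is_affine Y -> X `<=` Y ->
  affine_dim X = affine_dim Y -> X = Y.
Proof.
move=> affX affY subXY eqd; have [x Xx] := affine_neq0 affX.
have XI : X `&` Y = X by apply: setIidl.
have XY0 : X `&` Y !=set0 by rewrite XI; exists x.
have := directionI affX affY XY0; rewrite XI => /esym/capv_idPl sub.
have eqD : direction X = direction Y.
  by apply/eqP; rewrite eqEdim sub -/(affine_dim Y) -eqd /=.
by apply/seteqP; split=> //; apply: affine_subset; rewrite ?eqD // setIC.
Qed.

Lemma dim_cap_hyperplane U W : (\dim W).+1 = \dim {: V} -> ~~ (U <= W)%VS ->
  (\dim (U :&: W)).+1 = \dim U.
Proof.
move=> dimW nUW; have := dimv_sum_cap U W.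
have := dimvS (subvf (U + W)).
have : (\dim W < \dim (U + W))%N.
  rewrite ltn_neqAle dimvS ?addvSr // andbT; apply: contra nUW => /eqP eqd.
  have -> : W = (U + W)%VS by apply/eqP; rewrite eqEdim addvSr eqd /=.
  exact: addvSl.
by lia.
Qed.

Lemma hyperplane_dim_direction H :
  is_hyperplane H -> (\dim (direction H)).+1 = \dim {: V}.
Proof. by move=> [x [U [dimU ->]]]; rewrite direction_affine. Qed.

(** The two directions span the whole space, so the difference of a point of H and a point x of X
    splits as u + w along them; x + u then lies in both sets. *)
Lemma hyperplane_meets X H : is_affine X -> is_hyperplane H ->
  ~~ (direction X <= direction H)%VS -> X `&` H !=set0.
Proof.
move=> affX hypH nsub.
have dimH := hyperplane_dim_direction hypH.
have full : (direction X + direction H)%VS = fullv.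
  apply/eqP; rewrite eqEdim subvf /=.
  by have := dimv_sum_cap (direction X) (direction H);
     have := dim_cap_hyperplane dimH nsub; lia.
have [x Xx] := affine_neq0 affX.
have affH := hyperplane_affine hypH.
have [h Hh] := affine_neq0 affH.
have : h - x \in (direction X + direction H)%VS by rewrite full memvf.
case/memv_addP=> u uX [w wH eqhx].
exists (x + u); split.
  by rewrite (affineE affX Xx) /affine_subspace /= addrAC subrr add0r.
rewrite (affineE affH Hh) /affine_subspace /=.
have eqh : h = u + (w + x) by rewrite addrA -eqhx subrK.
have -> : x + u - h = - w.
  by rewrite eqh [x + u]addrC opprD addrACA subrr add0r opprD addrCA subrr addr0.
by rewrite memvN.
Qed.

End AffineSubspaces.

(** * Alternating sums over subfamilies *)

Section InclusionExclusion.
Set Implicit Arguments.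
Unset Strict Implicit.
Variables (V : Type) (R : zmodType).
Local Open Scope classical_set_scope.
Implicit Types (phi : set V -> R) (X H : set V) (s : seq (set V)).

(* The sum of (-1)^#|B| phi(X `&` \bigcap_(H in B) H) over the subfamilies B
   of s; the recursion is deletion-restriction. *)
Fixpoint incl_excl phi X s : R :=
  if s is H :: s' then incl_excl phi X s' - incl_excl phi (X `&` H) s' else phi X.

Lemma incl_excl_set0 phi s : phi set0 = 0 -> incl_excl phi set0 s = 0.
Proof. by move=> phi0; elim: s => //= H s IH; rewrite set0I IH subrr. Qed.

(** Once the recursion reaches H, cutting by H changes nothing and the two branches cancel; cuts
    made earlier only shrink X and so keep it inside H. *)
Lemma incl_excl_subset phi X H s :
  H \in s -> X `<=` H -> incl_excl phi X s = 0.
Proof.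
elim: s X => // G s IH X; rewrite inE => /orP[/eqP-> XG|Hs XH] /=.
  by rewrite setIidl // subrr.
by rewrite !IH ?subrr // => x [/XH].
Qed.

End InclusionExclusion.

(** * Binomial bounds for inclusion-exclusion sums truncated by codimension *)

Section Bounds.
Set Implicit Arguments.
Unset Strict Implicit.
Variables (K : fieldType) (V : vectType K).
Local Open Scope classical_set_scope.
Implicit Types (X H : set V) (s : seq (set V)).
Local Notation n := (\dim {: V}).

(** The nonemptiness test discards [set0], whose [affine_dim] is the junk value 0. Adding j to the
    dimension avoids truncated subtraction. *)
Definition codim_le (j : nat) X : int :=
  (`[< X !=set0 >] && (n <= affine_dim X + j)%N)%:R.

Local Notation f j := (incl_excl (codim_le j)).

Definition lineality s : {vspace V} := (\bigcap_(H <- s) direction H)%VS.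

(** The common direction of X and all members of s; its codimension in [direction X] serves as the
    rank of s restricted to X. *)
Definition lineality_in X s : {vspace V} := (direction X :&: lineality s)%VS.

Lemma codim_le_set0 j : codim_le j set0 = 0.
Proof. by rewrite /codim_le asboolF // => -[]. Qed.

Lemma codim_le_affine j X :
  is_affine X -> codim_le j X = (n <= affine_dim X + j)%N%:R.
Proof. by move=> affX; rewrite /codim_le asboolT //; exact: affine_neq0. Qed.

Lemma lineality_in_nil X : lineality_in X [::] = direction X.
Proof. by rewrite /lineality_in /lineality big_nil capvf. Qed.

Lemma lineality_in_cons X H s :
  lineality_in X (H :: s) = (direction H :&: lineality_in X s)%VS.
Proof.
by rewrite /lineality_in /lineality big_cons !capvA [(direction X :&: _)%VS]capvC.
Qed.

Lemma lineality_in_setI X H s : is_affine X -> is_affine H ->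
  X `&` H !=set0 -> lineality_in (X `&` H) s = lineality_in X (H :: s).
Proof.
move=> affX affH XH; rewrite lineality_in_cons /lineality_in directionI //.
by rewrite [(direction X :&: _)%VS]capvC capvA.
Qed.

Lemma set0_or_nonempty X : X = set0 \/ X !=set0.
Proof. by case: (pselect (X !=set0)) => [|/set0P/negP/negPn/eqP]; [right|left]. Qed.

(** Every nonempty intersection of X with members of s has a direction containing
    [lineality_in X s], hence codimension at most j already; a larger threshold admits no new
    term. *)
Lemma incl_excl_codim_stable s : {in s, forall H, is_affine H} ->
  forall X j, is_affine X -> (n <= \dim (lineality_in X s) + j)%N ->
  f j.+1 X s = f j X s.
Proof.
elim: s => [|H s IH] affs X j affX.
  rewrite lineality_in_nil /= !codim_le_affine // /affine_dim => le.
  by rewrite !(leq_trans le) // leq_add2l.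
have [affH {}affs] := proj1 forall_cons affs.
move=> le /=; congr (_ - _).
  apply: IH => //; apply: leq_trans le _; rewrite leq_add2r.
  by rewrite lineality_in_cons dimvS ?capvSr.
have [->|XH] := set0_or_nonempty (X `&` H).
  by rewrite !incl_excl_set0 ?codim_le_set0.
by apply: IH => //; [exact: affineI|rewrite lineality_in_setI].
Qed.

Lemma affine_dimI X H : is_affine X -> is_hyperplane H ->
  ~~ (direction X <= direction H)%VS ->
  (affine_dim (X `&` H)).+1 = affine_dim X.
Proof.
move=> affX hypH nsub; rewrite /affine_dim directionI //.
- by apply: dim_cap_hyperplane => //; exact: hyperplane_dim_direction.
- exact: hyperplane_affine.
- exact: hyperplane_meets.
Qed.

(** No nonempty intersection of X with members of s has its direction inside that of H. So H meets
    each of them and lowers its dimension by exactly one, which the shifted threshold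
    compensates. *)
Lemma incl_excl_coloop s : {in s, forall H, is_affine H} ->
  forall X H j, is_affine X -> is_hyperplane H ->
  ~~ (lineality_in X s <= direction H)%VS ->
  f j.+1 (X `&` H) s = f j X s.
Proof.
elim: s => [|G s IH] affs X H j affX hypH.
  rewrite lineality_in_nil /= => nsub.
  have XH := hyperplane_meets affX hypH nsub.
  rewrite !codim_le_affine //; last exact: affineI (hyperplane_affine hypH) _.
  by rewrite -(affine_dimI affX hypH nsub) addSnnS.
have [affG {}affs] := proj1 forall_cons affs.
move=> nsub /=; congr (_ - _).
  apply: IH => //; apply: contra nsub; apply: subv_trans.
  by rewrite lineality_in_cons capvSr.
have [XG0|XG] := set0_or_nonempty (X `&` G).
  by rewrite setIAC XG0 set0I !incl_excl_set0 ?codim_le_set0.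
rewrite setIAC; apply: IH => //; first exact: affineI.
by rewrite lineality_in_setI.
Qed.

(** Cutting X never raises its dimension, so every term misses the threshold. *)
Lemma incl_excl_codim_lt s : {in s, forall H, is_affine H} ->
  forall X j, is_affine X -> (affine_dim X + j < n)%N -> f j X s = 0.
Proof.
elim: s => [|H s IH] affs X j affX lt.
  by rewrite /= codim_le_affine // leqNgt lt.
have [affH {}affs] := proj1 forall_cons affs.
rewrite /= IH // sub0r.
have [->|XH] := set0_or_nonempty (X `&` H).
  by rewrite incl_excl_set0 ?codim_le_set0 ?oppr0.
rewrite IH ?oppr0 //; first exact: affineI.
apply: leq_ltn_trans lt; rewrite leq_add2r /affine_dim directionI //.
by rewrite dimvS ?capvSl.
Qed.

(** Each H cuts X in the empty set or in a smaller dimension, so only the empty subfamily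
    contributes. *)
Lemma incl_excl_codim0 s : {in s, forall H, is_hyperplane H} ->
  forall X j, is_affine X -> (affine_dim X + j)%N = n ->
  {in s, forall H, ~ X `<=` H} -> f j X s = 1.
Proof.
elim: s => [|H s IH] hyps X j affX eqn.
  by rewrite /= codim_le_affine // eqn leqnn.
have [hypH {}hyps] := proj1 forall_cons hyps.
move=> /forall_cons[nXH loopless]; rewrite /= IH //.
have affs : {in s, forall H, is_affine H} by move=> G /hyps/hyperplane_affine.
have affH := hyperplane_affine hypH.
have [->|XH] := set0_or_nonempty (X `&` H).
  by rewrite incl_excl_set0 ?codim_le_set0 ?subr0.
have nsub : ~~ (direction X <= direction H)%VS.
  by apply/negP => sub; apply: nXH; exact: affine_subset.
rewrite incl_excl_codim_lt ?subr0 //; first exact: affineI.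
by rewrite -addSn (affine_dimI affX hypH nsub) eqn.
Qed.

(** Here [c] is the codimension of X and [rho] the rank of s restricted to X. If a member of s
    contained X, the sum would be 0 by [incl_excl_subset] and the lower bound would fail at k =
    0. *)
Lemma incl_excl_bounds s : {in s, forall H, is_hyperplane H} ->
  forall X c rho k, is_affine X -> (affine_dim X + c)%N = n ->
  (\dim (lineality_in X s) + rho)%N = affine_dim X ->
  {in s, forall H, ~ X `<=` H} ->
  ((k <= rho)%N -> 'C(rho.-1, k)%:R <= (-1) ^+ k * f (c + k) X s) /\
  ((k <= rho.+1)%N -> (-1) ^+ k * f (c + k) X s <= 'C((size s).-1, k)%:R).
Proof.
elim: s => [|H s IH] hyps X c rho k affX dimX.
  rewrite lineality_in_nil => rk _.
  have {rk}-> : rho = 0 by rewrite /affine_dim in rk; lia.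
  rewrite /= codim_le_affine // addnA dimX leq_addr mulr1.
  by case: k => [|[|k]] //; rewrite expr0.
have [hypH {}hyps] := proj1 forall_cons hyps.
move=> rk /forall_cons[nXH loopless].
have affs : {in s, forall H, is_affine H} by move=> G /hyps/hyperplane_affine.
have affH := hyperplane_affine hypH.
(* If H is parallel to X, then X and H are disjoint, since H does not contain X. Restriction
   contributes nothing and the rank is unchanged. *)
have [sub|nsub] := boolP (direction X <= direction H)%VS.
  have [XH0|XH] := set0_or_nonempty (X `&` H); last first.
    by case: nXH; exact: affine_subset.
  have linE : lineality_in X (H :: s) = lineality_in X s.
    rewrite lineality_in_cons; apply/capv_idPr; apply: subv_trans sub.
    exact: capvSl.
  rewrite linE in rk; have [lo up] := IH hyps X c rho k affX dimX rk loopless.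
  rewrite /= XH0 incl_excl_set0 ?codim_le_set0 // subr0; split=> // /up le.
  by apply: le_trans le _; rewrite ler_nat leq_bin2l // leq_pred.
have XH := hyperplane_meets affX hypH nsub.
have affXH := affineI affX affH XH.
have dimXH := affine_dimI affX hypH nsub.
have dimXHc : (affine_dim (X `&` H) + c.+1)%N = n by rewrite addnS -addSn dimXH.
case: k => [|k].
  by rewrite addn0 incl_excl_codim0 ?bin0 ?mul1r //; apply/forall_cons.
(* The sign of the restricted term is absorbed by passing from k + 1 to k, and its threshold is
   rewritten relative to codimension [c.+1]. *)
rewrite /= mulrBr [in X in _ - X]exprS mulN1r mulNr opprK -[in X in _ + X]addSnnS.
(* H depends on s: deletion keeps the rank, while restriction lowers it by one. *)
have [subD|nsubD] := boolP (lineality_in X s <= direction H)%VS.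
  have s_gt0 : (0 < size s)%N.
    by case: (s) subD nsub => //; rewrite lineality_in_nil => ->.
  have linE : lineality_in X (H :: s) = lineality_in X s.
    by rewrite lineality_in_cons; apply/capv_idPr.
  rewrite linE in rk.
  have linH : lineality_in (X `&` H) s = lineality_in X s.
    by rewrite lineality_in_setI.
  have dimD : (\dim (lineality_in X s) <= affine_dim (X `&` H))%N.
    by rewrite -linH dimvS ?capvSl.
  case: rho rk => [|rho] rk; first by lia.
  have rkH : (\dim (lineality_in (X `&` H) s) + rho)%N = affine_dim (X `&` H).
    by rewrite linH; lia.
  have [lo up] := IH hyps X c rho.+1 k.+1 affX dimX rk loopless.
  (* Deletion alone already gives the lower bound, so restriction need only be nonnegative; its
     upper bound supplies the second term of Pascal's rule. Both claims survive when the restricted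
     sum degenerates to 0. *)
  have [loH upH] : ((k <= rho)%N -> 0 <= (-1) ^+ k * f (c.+1 + k) (X `&` H) s) /\
      ((k <= rho.+1)%N ->
        (-1) ^+ k * f (c.+1 + k) (X `&` H) s <= 'C((size s).-1, k)%:R).
    have [loopH|] := pselect {in s, forall G, ~ X `&` H `<=` G}.
      have [loH upH] := IH hyps (X `&` H) c.+1 rho k affXH dimXHc rkH loopH.
      by split=> // /loH; apply: le_trans.
    move=> /existsNP[G] /not_implyP[Gs] /contrapT sub.
    by rewrite (incl_excl_subset _ Gs sub) mulr0.
  split=> lek; first by rewrite -[leLHS]addr0 lerD ?lo ?loH.
  case: (size s) s_gt0 up upH => //= m _ up upH.
  by rewrite binS natrD lerD ?up ?upH.
(* H is independent of s: deletion lowers the rank by one, and by [incl_excl_coloop] the restricted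
   sum becomes one over X. *)
have dimD : (\dim (lineality_in X (H :: s))).+1 = \dim (lineality_in X s).
  rewrite lineality_in_cons capvC.
  by apply: dim_cap_hyperplane => //; exact: hyperplane_dim_direction.
have dimDX : (\dim (lineality_in X s) <= affine_dim X)%N by rewrite dimvS ?capvSl.
case: rho rk => [|rho] rk; first by lia.
have rks : (\dim (lineality_in X s) + rho)%N = affine_dim X by lia.
rewrite (incl_excl_coloop affs) //.
have [lek|ltk] := leqP rho k.
  (* From the rank of s on, the truncated sums are stable, so consecutive signed terms cancel; the
     lower binomial is 0 as well. *)
  have -> : f (c + k.+1) X s = f (c + k) X s.
    by rewrite addnS incl_excl_codim_stable //; lia.
  rewrite exprS mulN1r mulNr addNr; split=> // lek'.
  by rewrite bin_small.
have [lo up] := IH hyps X c rho k affX dimX rks loopless.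
have [lo' up'] := IH hyps X c rho k.+1 affX dimX rks loopless.
have s_gt0 : (0 < size s)%N.
  by move: rks; case: (s) => //; rewrite lineality_in_nil /affine_dim; lia.
split=> _.
  case: rho ltk lo lo' {rk rks up up'} => //= rho ltk lo lo'.
  by rewrite binS natrD lerD ?lo ?lo' // ltnW.
case: (size s) s_gt0 up up' => //= m _ up up'.
by rewrite binS natrD lerD ?up ?up' //; lia.
Qed.

End Bounds.

(** * Whitney's theorem for the intersection poset *)

(** The sums over all lower sets form a triangular system, solved uniquely by induction on the size
    of the lower set. *)
Lemma mobius_unique (d : Order.disp_t) (T : finPOrderType d) (x0 : T)
    (g : T -> int) : (forall x, (x0 <= x)%O) ->
  (forall z, \sum_(y | (y <= z)%O) g y = (z == x0)%:R) ->
  forall y, mobius x0 y = g y.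
Proof.
move=> x0_le sum_g y.
have [N] := ubnP #|[set z : T | (z <= y)%O]|; elim: N y => // N IH y leN.
have sum_mu : \sum_(z | (z <= y)%O) mobius x0 z = (y == x0)%:R.
  have [->|neq] := eqVneq y x0.
    rewrite (big_pred1 x0) ?mobiusxx // => z.
    by apply/idP/eqP => [zx|-> //]; apply/le_anti; rewrite zx x0_le.
  rewrite -[RHS](@mobius_sum0 _ _ x0 y) ?lt_neqAle 1?eq_sym ?neq ?x0_le //.
  by apply: eq_bigl => z; rewrite x0_le.
have := sum_g y; rewrite -sum_mu (bigD1 y) //= [RHS](bigD1 y) //=.
rewrite [X in _ + X = _](eq_bigr (mobius x0)) => [/addIr //|z /andP[zy neq]].
apply/esym/IH/(leq_trans _ (ltnSE leN))/proper_card/properP; split.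
  by apply/fintype.subsetP => u; rewrite !inE => /le_trans; apply.
by exists y; rewrite !inE ?lexx // lt_geF // lt_neqAle neq.
Qed.

Section Intersections.
Set Implicit Arguments.
Unset Strict Implicit.
Variables (K : fieldType) (V : vectType K) (A : {fset set V}).
Hypothesis hypA : forall H : set V, H \in A -> is_hyperplane H.
Local Open Scope classical_set_scope.
Local Notation L := (intersection_poset A).
Local Notation n := (\dim {: V}).
Implicit Types (X H : set V) (Y Z : L).

Lemma intersectionsP X : X \in intersections A <-> X !=set0 /\
  exists2 B : {fset set V}, (B `<=` A)%fset & X = \bigcap_(H in [set` B]) H.
Proof.
rewrite !inE /=; split=> [/andP[/imfsetP[/= B]]|[X0 [B BA eqX]]].
  by rewrite fpowersetE => BA eqX /asboolP X0; split=> //; exists B.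
apply/andP; split; last exact/asboolP.
by rewrite eqX; apply: in_imfset; rewrite /= fpowersetE.
Qed.

Lemma intersection_neq0 Y : val Y !=set0.
Proof. by have /intersectionsP[] := valP Y. Qed.

Lemma intersectionsI X H : X \in intersections A -> H \in A ->
  X `&` H !=set0 -> X `&` H \in intersections A.
Proof.
move=> /intersectionsP[_ [B BA eqX]] HA XH; apply/intersectionsP; split=> //.
exists (H |` B)%fset; first by rewrite fsubUset fsub1set HA.
by rewrite bigcap_fsetU1 setIC eqX.
Qed.

Lemma memv_lineality s v :
  v \in lineality s <-> {in s, forall H : set V, v \in direction H}.
Proof.
elim: s => [|H s IH]; first by rewrite /lineality big_nil memvf.
rewrite /lineality big_cons memv_cap; split.
  by move=> /andP[vH /IH vs]; apply/forall_cons.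
by move=> /forall_cons[vH vs]; apply/andP; split=> //; apply/IH.
Qed.

Lemma intersection_affineE X : X \in intersections A ->
  exists x (B : {fset set V}), (B `<=` A)%fset /\ X = affine_subspace x (lineality B).
Proof.
move=> /intersectionsP[[x Xx] [B BA eqX]]; exists x, B; split=> //.
rewrite eqX; rewrite eqX in Xx.
have BE H : H \in B -> H = affine_subspace x (direction H).
  move=> HB; apply: affineE; last exact: Xx.
  by apply/hyperplane_affine/hypA/(fsubsetP BA).
apply/seteqP; split=> y.
  move=> By; apply/memv_lineality => H HB.
  by have := By H HB; rewrite {1}(BE H HB).
move=> /memv_lineality yB H HB; rewrite (BE H HB); exact: yB.
Qed.

Lemma intersection_affine Y : is_affine (val Y).
Proof.
by have [x [B [_ ->]]] := intersection_affineE (valP Y); exists x, (lineality B).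
Qed.

Lemma lineality_le_direction Y : (lineality A <= direction (val Y))%VS.
Proof.
have [x [B [BA ->]]] := intersection_affineE (valP Y); rewrite direction_affine.
apply/subvP => v /memv_lineality vA; apply/memv_lineality => H HB.
by apply: vA; exact: (fsubsetP BA).
Qed.

(** Along a chain of intersections dimensions are distinct, and all lie between that of
    [lineality A] and n. *)
Lemma arrangement_rank_le : (arrangement_rank A + \dim (lineality A) <= n)%N.
Proof.
set D := \dim (lineality A); have leD : (D <= n)%N by rewrite dimvS ?subvf.
suff : (arrangement_rank A <= n - D)%N by lia.
apply/bigop.bigmax_leqP => Z _; apply/bigop.bigmax_leqP => C chainC.
suff : (#|C| <= #|'I_(n - D).+1|)%N by rewrite card_ord -subn1 leq_subLR add1n; exact.
have dimL Y : (D <= affine_dim (val Y) <= n)%N.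
  by rewrite dimvS ?lineality_le_direction //= dimvS ?subvf.
apply: (@leq_card_in _ _ (fun Y : L => inord (affine_dim (val Y) - D))).
move=> X Y XC YC /(congr1 val).
have /= dX := dimL X; have /= dY := dimL Y.
rewrite /= !inordK; [move=> eqd|lia|lia].
have {}eqd : affine_dim (val X) = affine_dim (val Y) by rewrite /=; lia.
have /forall_inP/(_ X XC)/andP[_ /forall_inP/(_ Y YC)] := chainC.
move=> /orP[] /asboolP sub; apply/val_inj; last first.
  by apply: affine_subset_eq => //; exact: intersection_affine.
by apply/esym/affine_subset_eq => //; exact: intersection_affine.
Qed.

(** The alternating sum is linear in [phi], and [phi] is a combination of point masses on the sets
    that the recursion visits; empty ones weigh 0. *)
Lemma incl_excl_delta (phi : set V -> int) s X : phi set0 = 0 ->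
  {subset s <= A} -> X \in intersections A ->
  incl_excl phi X s =
  \sum_(Y : L) incl_excl (fun X => (X == val Y)%:R) X s * phi (val Y).
Proof.
move=> phi0; elim: s X => [|H s IH] X sA XL /=.
  rewrite (bigD1 (FSetSub XL)) //= eqxx mul1r big1 ?addr0 // => Y neq.
  have [eqXY|] := eqVneq X (val Y); last by rewrite mul0r.
  by case/eqP: neq; apply/val_inj.
have HA : H \in A by apply: sA; rewrite mem_head.
have {}sA : {subset s <= A} by move=> G Gs; apply: sA; rewrite inE Gs orbT.
under eq_bigr do rewrite mulrBl.
rewrite sumrB -IH //; congr (_ - _).
have [->|XH] := set0_or_nonempty (X `&` H); last by apply/IH/intersectionsI.
rewrite incl_excl_set0 // big1 // => Y _; rewrite incl_excl_set0 ?mul0r //.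
have [eq0|//] := eqVneq set0 (val Y).
by have [x] := intersection_neq0 Y; rewrite -eq0.
Qed.

(** Only subfamilies of the members containing Z count, and their signs cancel unless no member
    contains Z. *)
Lemma incl_excl_superset (Z X : set V) s :
  incl_excl (fun X => `[< Z `<=` X >]%:R : int) X s =
  `[< Z `<=` X /\ {in s, forall H, ~ Z `<=` H} >]%:R.
Proof.
elim: s X => [|H s IH] X /=.
  by congr (nat_of_bool _)%:R; apply: asbool_equiv_eq; split=> [|[]].
rewrite !IH; have [ZH|nZH] := pselect (Z `<=` H).
  rewrite [in RHS]asboolF => [|[_ /forall_cons[]//]].
  rewrite (@asbool_equiv_eq _ (Z `<=` X /\ {in s, forall H, ~ Z `<=` H})) ?subrr //.
  by rewrite subsetI; split=> -[] // [].
rewrite (@asboolF (Z `<=` X `&` H /\ _)); last by rewrite subsetI => -[[]].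
rewrite subr0; congr (nat_of_bool _)%:R; apply: asbool_equiv_eq.
by split=> -[ZX] => [|/forall_cons[]] *; split=> //; apply/forall_cons.
Qed.

Lemma hyperplane_proper H : is_hyperplane H -> ~ [set: V] `<=` H.
Proof.
move=> hypH sub; have := hyperplane_dim_direction hypH.
have -> : H = [set: V] by apply/seteqP; split.
by rewrite directionT => /eqP; rewrite -[X in _ == X]addn0 -addn1 eqn_add2l.
Qed.

(** Whitney's theorem: the signed count of subfamilies with intersection Y is the Möbius value at Y.
    By [mobius_unique] it suffices to sum these counts over all Y containing Z, which
    [incl_excl_superset] evaluates. *)
Lemma incl_excl_mobius (phi : set V -> int) : phi set0 = 0 ->
  incl_excl phi [set: V] A = \sum_(Y : L) mobius (\bot)%O Y * phi (val Y).
Proof.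
move=> phi0; rewrite (incl_excl_delta phi0) ?setT_intersection //.
apply: eq_bigr => Y _; congr (_ * _); apply/esym; move: Y.
apply: mobius_unique => [Y|Z]; first exact: le0x.
transitivity (`[< val Z `<=` [set: V] /\
    {in enum_fset A, forall H, ~ val Z `<=` H} >]%:R : int).
  rewrite -incl_excl_superset incl_excl_delta ?setT_intersection //; last first.
    by rewrite asboolF // subset0 => Z0; have [x] := intersection_neq0 Z; rewrite Z0.
  rewrite big_mkcond /=; apply: eq_bigr => Y _.
  by rewrite /Order.le /= /rev_incl; case: asboolP => _; rewrite ?mulr1 ?mulr0.
congr (nat_of_bool _)%:R; apply/asboolP/eqP => [[_ nZ]|->]; last first.
  by split=> // H HA; apply/hyperplane_proper/hypA.
(* Z lies in every member of a family B defining it, so B must be empty and Z the whole space. *)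
apply/val_inj => /=; have /intersectionsP[_ [B BA eqZ]] := valP Z.
have [B0|[H HB]] := fset_0Vmem B.
  by rewrite [LHS]eqZ B0 set_fset0 bigcap_set0.
by case: (nZ H (fsubsetP BA _ HB)); rewrite eqZ => x; apply.
Qed.

End Intersections.

(** * From characteristic coefficients to the binomial bounds *)

(** For m = 0 and k > 0 the two sides differ: the generalized coefficient at -1 is a sign, the
    natural one is 0. *)
Lemma gbinom_pred (m k : nat) : (0 < m)%N || (k == 0)%N ->
  gbinom (m%:R - 1 : rat) k = 'C(m.-1, k)%:R.
Proof.
case: k => [|k]; first by rewrite /gbinom big_ord0 fact0 divr1 bin0.
case: m => // m _; rewrite -natr1 addrK /=.
rewrite /gbinom; set j := k.+1; apply/(canLR (mulfK _)).
  by rewrite pnatr_eq0 -lt0n fact_gt0.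
rewrite -natrM bin_ffact; have [lejm|ltmj] := leqP j m.
  rewrite ffact_prod natr_prod; apply: eq_bigr => i _.
  by rewrite natrB // ltnW // (leq_trans (ltn_ord i)).
by rewrite ffact_small // (bigD1 (Ordinal ltmj)) //= subrr mul0r.
Qed.

Lemma sum_codim_indicator (n k e : nat) : (k <= n)%N -> (e <= n)%N ->
  \sum_(i < k.+1) (n - i == e)%N%:R = (n <= e + k)%N%:R :> int.
Proof.
move=> le_kn le_en; have [le|lt] := leqP n (e + k); last first.
  by rewrite big1 // => i _; case: eqP => // eqni; have := ltn_ord i; lia.
have ltk : (n - e < k.+1)%N by lia.
rewrite (bigD1 (Ordinal ltk)) //= subKn // eqxx big1 ?addr0 // => i neq.
case: eqP => // eqni; case/eqP: neq; apply/val_inj => /=.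
by have := ltn_ord i; lia.
Qed.

Theorem corollary2p5 (K : fieldType) (V : vectType K) (n m r : nat)
    (A : {fset set V}) (a : nat -> int)
    (dimV : \dim {: V} = n)
    (hypA : forall H : set V, H \in A -> is_hyperplane H)
    (cardA : #|` A| = m)
    (rankA : arrangement_rank A = r)
    (chiA : characteristic_poly A
            = \sum_(i < r.+1) ((-1) ^+ i * a i) *: 'X^(n - i))
    (k : nat) (le_kr : (k <= r)%N) :
  gbinom (r%:R - 1 : rat) k
    <= ((-1) ^+ k * \sum_(i < k.+1) (-1) ^+ i * a i)%:~R
    <= gbinom (m%:R - 1 : rat) k.
Proof.
have le_rn := arrangement_rank_le hypA; rewrite rankA dimV in le_rn.
(* Since r is at most n, the exponents n - i do not truncate and are distinct, so each [a i] can be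
   read off. *)
have coefA (i : nat) : (i <= r)%N ->
    (characteristic_poly A)`_(n - i) = (-1) ^+ i * a i.
  move=> le_ir; have lt_ir : (i < r.+1)%N by [].
  rewrite chiA coef_sum (bigD1 (Ordinal lt_ir)) //= coefZ coefXn eqxx mulr1.
  rewrite big1 ?addr0 // => j neq; rewrite coefZ coefXn.
  case: eqP => [eqnij|]; last by rewrite mulr0.
  case/eqP: neq; apply/val_inj => /=; have := ltn_ord j; lia.
(* The first k + 1 signed coefficients collect the Möbius values of all intersections of codimension
   at most k. *)
have sumE : \sum_(i < k.+1) (-1) ^+ i * a i =
    incl_excl (codim_le k) [set: V]%classic A.
  rewrite (incl_excl_mobius hypA) ?codim_le_set0 //.
  under eq_bigr => i _ do
    rewrite -coefA ?(leq_trans (ltnSE (ltn_ord i))) // coef_sum.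
  rewrite exchange_big /=; apply: eq_bigr => Y _.
  under eq_bigr => i _ do rewrite coefZ coefXn.
  rewrite -mulr_sumr codim_le_affine; last exact: intersection_affine hypA Y.
  rewrite dimV sum_codim_indicator -?dimV ?dimvS ?subvf //.
  by rewrite dimV (leq_trans le_kr) //; lia.
rewrite sumE.
(* The rank of A measured by directions, to which the bounds apply with X the whole space. *)
set rho := (n - \dim (lineality A))%N.
have leD : (\dim (lineality A) <= n)%N by rewrite -dimV dimvS ?subvf.
(* An empty arrangement has r = 0, which forces k = 0. *)
have m_gt0 : (0 < m)%N || (k == 0)%N.
  rewrite -cardA -implyNb -leqNgt leqn0 cardfs_eq0; apply/implyP => /eqP A0.
  move: le_rn; rewrite A0 /lineality big_nil dimV; lia.
have r_gt0 : (0 < r)%N || (k == 0)%N by lia.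
have affT := @affineT K V.
have dimT : affine_dim [set: V]%classic = n by rewrite /affine_dim directionT.
have [] := @incl_excl_bounds K V A hypA [set: V]%classic 0%N rho k affT.
- by rewrite addn0 dimT dimV.
- by rewrite /lineality_in directionT capfv dimT subnKC.
- by move=> H HA; apply/hyperplane_proper/hypA.
have le_rrho : (r <= rho)%N by rewrite /rho; lia.
move=> /(_ (leq_trans le_kr le_rrho)) lo /(_ (leqW (leq_trans le_kr le_rrho))) up.
have natE (p : nat) : p%:R = (p%:R : int)%:~R :> rat by rewrite natz -pmulrn.
rewrite !gbinom_pred // !natE !ler_int; apply/andP; split.
  (* As r is at most [rho], monotonicity of binomials carries the bound from [rho] down to r. *)
  by apply: le_trans lo; rewrite ler_nat leq_bin2l //; lia.
by rewrite -cardA.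
Qed.
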